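(* Let $G$ be either the complete graph $K_n$ with $n \geq 5$ or the complete bipartite graph $K_{n,n}$ with $n \geq 10$. Then the inequality $$\frac{P^{*}_{DP}(G,3)}{3^{|V(G)|}} \geq \frac{P^{*}_{DP}(G,2)}{2^{|V(G)|}}$$ does not hold; that is, $\dfrac{P^{*}_{DP}(G,3)}{3^{|V(G)|}} < \dfrac{P^{*}_{DP}(G,2)}{2^{|V(G)|}}$.
   Context: All graphs are finite, simple, and nonempty (at least one vertex). $K_{m,n}$ is the complete bipartite graph with partite sets of sizes $m$ and $n$. For a graph $H$ and $S_1,S_2 \subseteq V(H)$, $E_H(S_1,S_2)$ is the set of edges of $H$ with one endpoint in $S_1$ and the other in $S_2$. A (DP-)cover of a graph $G$ is a pair $\mathcal{H} = (L,H)$, where $H$ is a graph and $L: V(G) \to 2^{V(H)}$ is a function such that: (1) $\{L(v) : v \in V(G)\}$ is a partition of $V(H)$ of size $|V(G)|$; (2) for every $v \in V(G)$, the induced subgraph $H[L(v)]$ is complete; (3) if $E_H(L(u),L(v))$ is nonempty, then $u=v$ or $uv \in E(G)$; (4) if $uv \in E(G)$, then $E_H(L(u),L(v))$ is a (possibly empty) matching. The cover is $k$-fold if $|L(v)| = k$ for every $v \in V(G)$, and a $k$-fold cover is full if $|E_H(L(u),L(v))| = k$ for every $uv \in E(G)$. An $\mathcal{H}$-coloring of $G$ is an independent set in $H$ of size $|V(G)|$. The dual DP color function $P^{*}_{DP}(G,k)$ is the maximum number of $\mathcal{H}$-colorings of $G$ over all full $k$-fold covers $\mathcal{H}$ of $G$.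 *)

(* Defs.v *)
From mathcomp Require Import all_boot all_order all_algebra.
From mathcomp Require Import boolp.
(* Not imported: classical_sets would shadow finset notions (trivIset, partition). *)
From mathcomp Require classical_sets.

Set Implicit Arguments.
Unset Strict Implicit.
Unset Printing Implicit Defensive.

Local Open Scope nat_scope.
Local Open Scope set_scope.

Record graph : Type := Graph {
  vertex :> finType;
  adj : rel vertex;
  adj_sym : symmetric adj;
  adj_irr : irreflexive adj;
  vertex_gt0 : 0 < #|vertex| }.

(* Graphs "equal to" K_n or K_{m,n} are taken up to relabelling of vertices. *)
Definition is_complete (G : graph) (n : nat) : Prop :=
  #|G| = n /\ forall u v : G, adj u v = (u != v).

Definition is_complete_bipartite (G : graph) (m n : nat) : Prop :=
  exists A B : {set G},
    [/\ A :|: B = [set: G], [disjoint A & B], #|A| = m, #|B| = n &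
        forall u v : G,
          adj u v = ((u \in A) && (v \in B)) || ((u \in B) && (v \in A))].

(* Edges are unordered, i.e. two-element sets of vertices. *)
Definition edges_between (H : graph) (S1 S2 : {set H}) : {set {set H}} :=
  [set [set x; y] | x in S1, y in S2 & adj x y].

Definition matching (H : graph) (M : {set {set H}}) : bool := trivIset M.

Definition clique (H : graph) (S : {set H}) : Prop :=
  {in S &, forall x y, x != y -> adj x y}.

Definition independent (H : graph) (S : {set H}) : bool :=
  [forall x in S, forall y in S, ~~ adj x y].

Record dp_cover (G : graph) : Type := DPCover {
  cover_graph : graph;
  lists : G -> {set cover_graph};
  lists_partition :
    partition [set lists v | v : G] [set: cover_graph]
    /\ #|[set lists v | v : G]| = #|G|;
  lists_clique : forall v, clique (lists v);
  lists_edges : forall u v,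
    edges_between (lists u) (lists v) != set0 -> u = v \/ adj u v;
  lists_matching : forall u v,
    adj u v -> matching (edges_between (lists u) (lists v)) }.

Definition fold_cover (G : graph) (k : nat) (C : dp_cover G) : Prop :=
  forall v, #|lists C v| = k.

Definition full_cover (G : graph) (k : nat) (C : dp_cover G) : Prop :=
  fold_cover k C /\
  forall u v, adj u v -> #|edges_between (lists C u) (lists C v)| = k.

Definition is_coloring (G : graph) (C : dp_cover G) (I : {set cover_graph C}) :
  bool := independent I && (#|I| == #|G|).

Definition num_colorings (G : graph) (C : dp_cover G) : nat :=
  #|[set I : {set cover_graph C} | is_coloring I]|.

Definition is_dual_dp (G : graph) (k m : nat) : Prop :=
  (exists2 C : dp_cover G, full_cover k C & num_colorings C = m) /\
  (forall C : dp_cover G, full_cover k C -> num_colorings C <= m).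

(* The default value 0 is only used for k = 0, when no full k-fold cover
   exists; see [dual_dpP]. *)
Definition dual_dp (G : graph) (k : nat) : nat :=
  classical_sets.xget 0 (is_dual_dp G k).

Section DualDPExists.
Context (G : graph) (k : nat) (k_gt0 : 0 < k).

Let W : finType := (G * 'I_k)%type.

Definition triv_adj : rel W := fun x y =>
  ((x.1 == y.1) && (x.2 != y.2)) || (adj x.1 y.1 && (x.2 == y.2)).

Lemma triv_adj_sym : symmetric triv_adj.
Proof.
by move=> x y; rewrite /triv_adj adj_sym (eq_sym x.1) (eq_sym x.2).
Qed.

Lemma triv_adj_irr : irreflexive triv_adj.
Proof. by move=> x; rewrite /triv_adj !eqxx adj_irr. Qed.

Lemma triv_gt0 : 0 < #|W|.
Proof. by rewrite card_prod card_ord muln_gt0 vertex_gt0. Qed.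

Definition triv_graph : graph := Graph triv_adj_sym triv_adj_irr triv_gt0.

Definition triv_lists (v : G) : {set triv_graph} := [set x : W | x.1 == v].

Lemma triv_lists_inj : injective triv_lists.
Proof.
move=> u v /setP /(_ ((u, Ordinal k_gt0) : W)).
by rewrite !inE /= eqxx => /esym/eqP.
Qed.

Lemma triv_partition :
  partition [set triv_lists v | v : G] [set: triv_graph]
  /\ #|[set triv_lists v | v : G]| = #|G|.
Proof.
split; last by rewrite card_imset //; exact: triv_lists_inj.
apply/and3P; split.
- rewrite eqEsubset subsetT /=; apply/subsetP => x _.
  by apply/bigcupP; exists (triv_lists x.1); rewrite ?imset_f ?inE.
- apply/trivIsetP => _ _ /imsetP[u _ ->] /imsetP[v _ ->] nuv.
  rewrite -setI_eq0; apply/eqP/setP => x; rewrite !inE.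
  apply/negP => /andP[/eqP xu /eqP xv]; case/eqP: nuv.
  by rewrite -xu xv.
- apply/imsetP => -[v _ /setP/(_ ((v, Ordinal k_gt0) : W))].
  by rewrite !inE eqxx.
Qed.

Lemma triv_clique v : clique (triv_lists v).
Proof.
move=> [a i] [b j]; rewrite !inE /= => /eqP-> /eqP-> nij.
by rewrite /triv_adj /= eqxx; apply/orP; left; apply: contraNneq nij => ->.
Qed.

Lemma triv_edges u v :
  edges_between (triv_lists u) (triv_lists v) != set0 -> u = v \/ adj u v.
Proof.
case/set0Pn => e /imset2P[[a i] [b j]].
rewrite !inE /= => /eqP eu /andP[/eqP ev]; rewrite {}eu {}ev /triv_adj /=.
by case/orP => /andP[uv _] _; [left; apply/eqP|right].
Qed.

Lemma triv_edgesE u v : adj u v ->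
  edges_between (triv_lists u) (triv_lists v) =
  [set [set ((u, i) : triv_graph); ((v, i) : triv_graph)] | i : 'I_k].
Proof.
move=> uv; apply/setP => e; apply/imset2P/imsetP.
- case=> -[a i] [b j]; rewrite !inE /= => /eqP-> /andP[/eqP->].
  rewrite /triv_adj /= => /orP[/andP[/eqP e' _]|/andP[_ /eqP<-]] ->.
    by rewrite e' adj_irr in uv.
  by exists i.
- case=> i _ ->; exists ((u, i) : triv_graph) ((v, i) : triv_graph) => //.
    by rewrite inE.
  by rewrite !inE eqxx /= /triv_adj /= uv eqxx orbT.
Qed.

Lemma triv_matching u v :
  adj u v -> matching (edges_between (triv_lists u) (triv_lists v)).
Proof.
move=> uv; rewrite triv_edgesE //.
apply/trivIsetP => _ _ /imsetP[i _ ->] /imsetP[j _ ->] nij.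
rewrite -setI_eq0; apply/eqP/setP => -[a l]; rewrite !inE.
apply/negP => /andP[li lj].
have il : l = i by case/orP: li => /eqP[].
have jl : l = j by case/orP: lj => /eqP[].
by rewrite -il -jl eqxx in nij.
Qed.

Definition triv_cover : dp_cover G :=
  DPCover triv_partition triv_clique triv_edges triv_matching.

Lemma triv_full : full_cover k triv_cover.
Proof.
split=> [v|u v uv] /=.
- rewrite -[RHS]card_ord -cardsT.
  rewrite -(card_imset _ (f := fun i : 'I_k => (v, i) : triv_graph)).
    apply: eq_card => -[a i]; rewrite !inE /=; apply/eqP/imsetP => [->|].
      by exists i.
    by case=> j _ [].
  by move=> i j [].
- rewrite triv_edgesE // card_imset ?card_ord // => i j.
  move/setP/(_ ((u, i) : triv_graph)); rewrite !inE eqxx /= => /esym.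
  by case/orP => /eqP[].
Qed.

Lemma num_colorings_bound (C : dp_cover G) :
  full_cover k C -> num_colorings C <= 2 ^ (#|G| * k).
Proof.
move=> [fk _]; have [pC cC] := lists_partition C.
have -> : #|G| * k = #|cover_graph C|.
  have fkC S : S \in [set lists C v | v : G] -> #|S| = k.
    by case/imsetP => v _ ->; exact: fk.
  by rewrite -cC -(card_uniform_partition fkC pC) cardsT.
rewrite -[X in 2 ^ X]cardsT -card_powerset.
by apply: subset_leq_card; apply/subsetP => I _; rewrite inE subsetT.
Qed.

Lemma dual_dpP : is_dual_dp G k (dual_dp G k).
Proof.
apply: classical_sets.xgetPex.
pose P m := `[< exists2 C : dp_cover G, full_cover k C & num_colorings C = m >].
have exP : exists m, P m.
  by exists (num_colorings triv_cover); apply/asboolP;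
     exists triv_cover; first exact: triv_full.
have ubP m : P m -> m <= 2 ^ (#|G| * k).
  by move=> /asboolP[C fC <-]; exact: num_colorings_bound.
case: (ex_maxnP exP ubP) => m /asboolP Pm maxm; exists m; split => // C fC.
by apply: maxm; apply/asboolP; exists C.
Qed.

End DualDPExists.

(* Main.v *)
Require Import Defs.
From mathcomp Require Import all_boot all_order all_algebra.
From mathcomp Require Import zify.
Import Order.TTheory GRing.Theory Num.Theory.

Set Implicit Arguments.
Unset Strict Implicit.
Unset Printing Implicit Defensive.

(** The full 2-fold cover that joins the opposite colors along every edge has
    two constant colorings ([dual_dp2_ge2]). So it is enough to show that every
    full 3-fold cover of [G] has fewer than [2 * (3/2) ^ #|G|] colorings.

    For [K_n] there are at most [3 * n] of them ([complete_num_colorings]). Fix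
    the color [c] of one vertex [v], in one of three ways. Every other vertex
    then keeps two colors, and two such vertices cannot show all four pairs of
    colors: a matching of three edges between lists of size three has an edge
    inside any two-by-two sublists. Colorings with this [c] thus form a family
    of VC-dimension at most one on [n - 1] coordinates, which has at most [n]
    members ([sauer_shelah1]).

    For [K_{n,n}] there are at most [6 * 2 ^ n] ([bipartite_num_colorings]).
    Sum over the partial colorings [g] of the side [A] the product over [b] in
    the other side [B] of the number [w b] of colors still free at [b]. By the
    arithmetic-geometric mean inequality this product is at most the mean over
    [b] of [w b ^ n], so it is enough to bound the sum over [g] of [w b ^ n]
    for one [b]. As [w b <= 2], that power is at most [w b], plus [2 ^ n] when
    [w b = 2]. The sum of [w b] is [3 * 2 ^ n], since a color of [b] excludes
    one color at each vertex of [A]; and [w b = 2] for at most three [g], since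
    all of [A] must then exclude the same color of [b].

    What remains is to compare [3 * n] and [6 * 2 ^ n] with [2 * (3/2) ^ n] and
    [2 * (9/4) ^ n]. *)

(** * Colorings as functions *)

Section Covers.
Context (G : graph) (C : dp_cover G).
Local Notation L := (lists C).

Lemma lists_total (x : cover_graph C) : exists v, x \in L v.
Proof.
have [/and3P[/eqP cov _ _] _] := lists_partition C.
have : x \in cover [set L v | v : G] by rewrite cov inE.
by case/bigcupP => _ /imsetP[v _ ->]; exists v.
Qed.

Lemma lists_inj u v x : x \in L u -> x \in L v -> u = v.
Proof.
have [/and3P[_ /trivIsetP tr _] card_lists] := lists_partition C.
have /imset_injP inj : #|[set L v | v : G]| == #|G| by rewrite card_lists.
move=> xu xv; apply: inj => //; apply/eqP/contraT => neq.
have := tr _ _ (imset_f _ (erefl : u \in G)) (imset_f _ (erefl : v \in G)) neq.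
by move/disjointFr/(_ xu); rewrite xv.
Qed.

Definition coloring_funs : {set {ffun G -> cover_graph C}} :=
  [set f : {ffun G -> cover_graph C} |
    [forall v, f v \in L v] && [forall u, forall v, ~~ adj (f u) (f v)]].

Lemma coloring_funsP (f : {ffun G -> cover_graph C}) :
  reflect ((forall v, f v \in L v) /\ (forall u v, ~~ adj (f u) (f v)))
          (f \in coloring_funs).
Proof.
rewrite inE; apply: (iffP andP) => -[/forallP fL fI]; split => //.
- by move=> u v; move/forallP/(_ u)/forallP: fI; apply.
- by apply/forallP => u; apply/forallP.
Qed.

(** An independent set meets each clique at most once, so one of size [#|G|]
    meets every list exactly once: it is the image of a choice function. *)
Lemma num_colorings_le_funs : num_colorings C <= #|coloring_funs|.
Proof.
apply: leq_trans (leq_imset_card (fun f : {ffun _ -> _} => f @: [set: G]) _).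
apply: subset_leq_card; apply/subsetP => I.
rewrite inE => /andP[/forall_inP indI /eqP cardI].
have [own ownP] := fin_all_exists lists_total.
have own_inj : {in I &, injective own}.
  move=> x y Ix Iy exy; apply/eqP/contraT => nxy.
  have := lists_clique (ownP x) _ nxy; rewrite exy ownP => /(_ isT) xy.
  by have /forall_inP/(_ y Iy) := indI x Ix; rewrite xy.
have own_full : own @: I = setT.
  by apply/eqP; rewrite eqEcard subsetT cardsT card_in_imset ?cardI /=.
have pick_color v : exists x, x \in I /\ own x = v.
  have : v \in own @: I by rewrite own_full.
  by case/imsetP => x Ix ->; exists x.
have [f fP] := fin_all_exists pick_color.
apply/imsetP; exists (finfun f).
  apply/coloring_funsP; split=> [v|u v]; rewrite !ffunE.
    by have [_ {2}<-] := fP v.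
  by have /forall_inP := indI _ (proj1 (fP u)); apply; case: (fP v).
apply/esym/eqP; rewrite eqEcard; apply/andP; split.
  by apply/subsetP => _ /imsetP[v _ ->]; rewrite ffunE; case: (fP v).
rewrite cardI card_imset ?cardsT // => u v; rewrite !ffunE => euv.
by rewrite -(proj2 (fP u)) -(proj2 (fP v)) euv.
Qed.

(** * Full covers *)

Lemma matched_unique u v x y z : adj u v -> x \in L u ->
  y \in L v -> z \in L v -> adj x y -> adj x z -> y = z.
Proof.
move=> uv xu yv zv xy xz.
have /trivIsetP tr := lists_matching C uv.
have edge w : w \in L v -> adj x w ->
    [set x; w] \in edges_between (L u) (L v).
  by move=> wv xw; apply/imset2P; exists x w => //; rewrite inE wv.
have [e|neq] := eqVneq [set x; y] [set x; z].
  have : y \in [set x; z] by rewrite -e !inE eqxx orbT.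
  rewrite !inE => /orP[/eqP yx|/eqP //].
  by move: xy; rewrite yx adj_irr.
have /disjointFr/(_ (set21 x y)) := tr _ _ (edge y yv xy) (edge z zv xz) neq.
by rewrite set21.
Qed.

(** The edges between two lists are determined by their ends in the first
    list; as there are as many of them as elements of that list, every element
    is an end. *)
Lemma full_matched k u v x : full_cover k C -> adj u v -> x \in L u ->
  exists y, y \in L v /\ adj x y.
Proof.
move=> [foldC fullC] uv xu.
pose X := [set x in L u | [exists y in L v, adj x y]].
pose mate x := odflt x [pick y in L v | adj x y].
have sub : edges_between (L u) (L v) \subset [set [set x; mate x] | x in X].
  apply/subsetP => e /imset2P[a b au].
  rewrite inE => /andP[bv ab] ->; apply/imsetP; exists a.
    by rewrite inE au; apply/existsP; exists b; rewrite bv.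
  rewrite /mate; case: pickP => [c /andP[cv ac]|/(_ b)]; last first.
    by rewrite bv ab.
  by rewrite (matched_unique uv au bv cv ab ac).
have XL : X = L u.
  apply/eqP; rewrite eqEcard; apply/andP; split.
    by apply/subsetP => a; rewrite inE => /andP[].
  rewrite foldC -(fullC _ _ uv).
  exact: leq_trans (subset_leq_card sub) (leq_imset_card _ _).
by move: xu; rewrite -XL inE => /andP[_ /exists_inP[y yv xy]]; exists y.
Qed.

(** The matching injects [X] into the second list, where [Y] leaves too little
    room for the image to avoid it. *)
Lemma full_adj_pair k u v (X Y : {set cover_graph C}) :
  full_cover k C -> adj u v -> X \subset L u -> Y \subset L v ->
  k < #|X| + #|Y| -> exists x y, [/\ x \in X, y \in Y & adj x y].
Proof.
move=> fullC uv /subsetP XL YL large; have [foldC _] := fullC.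
have mateE x : exists y, x \in X -> y \in L v /\ adj x y.
  have [xX|_] := boolP (x \in X); last by exists x.
  by have [y yP] := full_matched fullC uv (XL x xX); exists y.
have [m mP] := fin_all_exists mateE.
have m_inj : {in X &, injective m}.
  move=> x y xX yX e; have [mx ax] := mP x xX; have [_ ay] := mP y yX.
  rewrite adj_sym in uv.
  by apply: (matched_unique uv mx (XL x xX) (XL y yX)); rewrite adj_sym // e.
have [/subset_leq_card|/subsetPn[y]] := boolP (m @: X \subset L v :\: Y).
  rewrite card_in_imset // cardsD (setIidPr YL) foldC.
  by have := subset_leq_card YL; rewrite foldC; lia.
case/imsetP => x xX -> mxN; exists x, (m x); have [mx ax] := mP x xX.
by split => //; move: mxN; rewrite inE mx andbT negbK.
Qed.

End Covers.

(** * Complete graphs *)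

(** The Sauer-Shelah lemma for VC-dimension at most one. Take [x] in [D]. If [f]
    and [g] differ only at [x], then deleting [g] makes the family determined
    by [D :\ x]: a second such pair [f'], [g'] would differ from the first at
    some [y], and all four pairs of values would occur at [x] and [y]. *)
Lemma sauer_shelah1 (T V : finType) (D : {set T}) (F : {set {ffun T -> V}}) :
  {in F &, forall f g : {ffun T -> V}, {in D, f =1 g} -> f = g} ->
  (forall t, #|[set f t | f : {ffun T -> V} in F]| <= 2) ->
  (forall s t, s != t -> #|[set (f s, f t) | f : {ffun T -> V} in F]| <= 3) ->
  #|F| <= #|D|.+1.
Proof.
have [n] := ubnP #|D|; elim: n => // n IHn in D F *; rewrite ltnS => Dn.
move=> det two three.
have [D0|[x xD]] := set_0Vmem D.
  rewrite D0 cards0; apply/card_le1_eqP => f g fF gF; apply: det => // t.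
  by rewrite D0 inE.
(* Agreement on [D] outside [x]. *)
pose eq_off (f g : {ffun T -> V}) := [forall t in D :\ x, f t == g t].
have eq_offP (f g : {ffun T -> V}) : reflect {in D :\ x, f =1 g} (eq_off f g).
  by apply: (iffP forall_inP) => e t /e/eqP.
have indF (E : {set {ffun T -> V}}) : E \subset F ->
    {in E &, forall f g, eq_off f g -> f = g} -> #|E| <= #|D|.
  move=> EF injE; move: Dn; rewrite (cardsD1 x D) xD => Dn.
  apply: IHn => //.
  - by move=> f g fE gE /eq_offP; apply: injE.
  - by move=> t; apply: leq_trans (subset_leq_card (imsetS _ EF)) (two t).
  - move=> s t st.
    by apply: leq_trans (subset_leq_card (imsetS _ EF)) (three s t st).
have nx (f g : {ffun T -> V}) : f \in F -> g \in F ->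
    {in D :\ x, f =1 g} -> f != g -> f x != g x.
  move=> fF gF e; apply: contraNneq => ex; apply/eqP/det => // t tD.
  by have [->|tx] := eqVneq t x; [|apply: e; rewrite !inE tx].
have [inj|] := boolP [forall f in F, forall g in F, eq_off f g ==> (f == g)].
  apply/leqW/indF => // f g fF gF efg; apply/eqP.
  by move/forall_inP/(_ f fF)/forall_inP/(_ g gF)/implyP: inj; apply.
case/forall_inPn => f fF /forall_inPn[g gF].
rewrite negb_imply => /andP[/eq_offP efg nfg].
rewrite (cardsD1 g) gF add1n ltnS; apply: indF; first exact: subsetDl.
move=> f' g'; rewrite !inE => /andP[nf' f'F] /andP[ng' g'F] /eq_offP efg'.
apply/eqP/contraT => nfg'.
have fgx := nx f g fF gF efg nfg.
have fgx' := nx f' g' f'F g'F efg' nfg'.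
(* Otherwise [f'], [g'] and [g] would take three values at [x]. *)
have [y yDx neqy] : exists2 y, y \in D :\ x & f y != f' y.
  apply/exists_inP/contraT => /exists_inPn eqy.
  have e' : {in D :\ x, f' =1 g}.
    by move=> t tD; rewrite -efg //; apply/esym/eqP; rewrite -[_ == _]negbK eqy.
  have e'' : {in D :\ x, g' =1 g} by move=> t tD; rewrite -efg' ?e'.
  have f'x := nx f' g f'F gF e' nf'.
  have g'x := nx g' g g'F gF e'' ng'.
  have := two x; rewrite leqNgt => /negP; case.
  apply: leq_trans (_ : #|[set g x; f' x; g' x]| <= _).
    rewrite -setUA cardsU1 cards2 !inE fgx' !(eq_sym (g x)).
    by rewrite (negPf f'x) (negPf g'x).
  apply: subset_leq_card; apply/subsetP => v; rewrite !inE -orbA.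
  by case/or3P => /eqP->; apply/imset_f.
have twox : f' x = f x /\ g' x = g x \/ f' x = g x /\ g' x = f x.
  have sub : [set f x; g x] = [set f x | f : {ffun T -> V} in F].
    apply/eqP; rewrite eqEcard cards2 fgx two andbT.
    by apply/subsetP => v; rewrite !inE => /orP[]/eqP->; apply/imset_f.
  have : f' x \in [set f x; g x] by rewrite sub; apply: imset_f.
  have : g' x \in [set f x; g x] by rewrite sub; apply: imset_f.
  rewrite !inE => /orP[]/eqP e1 /orP[]/eqP e2; rewrite e1 e2 ?eqxx // in fgx' *;
    by [left|right].
have yx : y != x by case/setD1P: yDx.
have := three x y; rewrite eq_sym yx => /(_ isT); rewrite leqNgt => /negP; case.
have egy := esym (efg y yDx); have eg'y := esym (efg' y yDx).
apply: leq_trans (_ : #|setX [set f x; g x] [set f y; f' y]| <= _).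
  by rewrite cardsX !cards2 fgx neqy.
apply: subset_leq_card; apply/subsetP => -[a b]; rewrite !inE /=.
case/andP => /orP[]/eqP-> /orP[]/eqP->; apply/imsetP.
- by exists f.
- by case: twox => -[ef eg]; [exists f'|exists g']; rewrite ?ef ?eg ?eg'y.
- by exists g; rewrite ?egy.
- by case: twox => -[ef eg]; [exists g'|exists f']; rewrite ?ef ?eg ?eg'y.
Qed.

Lemma complete_num_colorings (G : graph) n (C : dp_cover G) :
  is_complete G n -> full_cover 3 C -> num_colorings C <= 3 * n.
Proof.
move=> [cardG adjG] fullC; have [foldC _] := fullC.
apply: leq_trans (num_colorings_le_funs C) _.
have /card_gt0P[v _] := vertex_gt0 G.
(* Split the colorings by the color [c] of a vertex [v]. *)
rewrite -sum1_card (partition_big (fun f : {ffun _ -> _} => f v)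
  (mem (lists C v))) /=; last by move=> f /coloring_funsP[].
rewrite -(foldC v) -sum_nat_const; apply: leq_sum => c cv.
rewrite (eq_bigl (mem [set f in coloring_funs C | f v == c])); last first.
  by move=> f; rewrite [RHS]inE.
rewrite sum1_card.
(* The colors at [t] that [c] leaves. *)
pose B t := if t == v then [set c] else [set x in lists C t | ~~ adj c x].
have FP (f : {ffun G -> cover_graph C}) :
    f \in [set f in coloring_funs C | f v == c] -> forall t, f t \in B t.
  rewrite inE => /andP[/coloring_funsP[fL fI] /eqP fv] t; rewrite /B.
  by case: eqP => [->|_]; rewrite !inE ?fv // fL -fv fI.
have cardB t : t != v -> #|B t| = 2.
  move=> tv; rewrite /B (negPf tv); have vt : adj v t by rewrite adjG eq_sym.
  have [d [dt cd]] := full_matched fullC vt cv.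
  have -> : [set x in lists C t | ~~ adj c x] = lists C t :\ d.
    apply/setP => x; rewrite !inE andbC; apply/andb_id2r => xt.
    have [->|xd] := eqVneq x d; first by rewrite cd.
    apply/negP => cx; case/eqP: xd; exact: matched_unique vt cv xt dt cx cd.
  by have := cardsD1 d (lists C t); rewrite foldC dt add1n => -[<-].
apply: leq_trans (sauer_shelah1 (D := [set~ v]) _ _ _) _.
- move=> f g fF gF e; apply/ffunP => t.
  have [->|tv] := eqVneq t v; last by apply: e; rewrite !inE.
  have := FP f fF v; have := FP g gF v.
  by rewrite /B eqxx !inE => /eqP-> /eqP->.
- move=> t; apply: (@leq_trans #|B t|).
    by apply/subset_leq_card/subsetP => _ /imsetP[f fF ->]; apply: FP.
  by have [->|/cardB->//] := eqVneq t v; rewrite /B eqxx cards1.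
- move=> s t st.
  have [sv|sv] := eqVneq s v; last have [tv|tv] := eqVneq t v.
  + apply: (@leq_trans #|setX (B s) (B t)|).
      by apply/subset_leq_card/subsetP => _ /imsetP[f fF ->]; rewrite inE !FP.
    have tv : t != v by rewrite -sv eq_sym.
    by rewrite cardsX (cardB t tv) /B sv eqxx cards1.
  + apply: (@leq_trans #|setX (B s) (B t)|).
      by apply/subset_leq_card/subsetP => _ /imsetP[f fF ->]; rewrite inE !FP.
    by rewrite cardsX cardB // /B tv eqxx cards1.
  have st' : adj s t by rewrite adjG.
  have subB u : u != v -> B u \subset lists C u.
    move=> uv; rewrite /B (negPf uv).
    by apply/subsetP => x; rewrite inE => /andP[].
  have [|x [y [xs yt xy]]] :=
      full_adj_pair fullC st' (subB s sv) (subB t tv) _.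
    by rewrite !cardB.
  apply: (@leq_trans #|setX (B s) (B t) :\ (x, y)|).
    apply/subset_leq_card/subsetP => _ /imsetP[f fF ->].
    rewrite !inE !FP // !andbT; apply/eqP => -[ex ey].
    move: fF; rewrite inE => /andP[/coloring_funsP[_ /(_ s t)]].
    by rewrite ex ey xy.
  have := cardsD1 (x, y) (setX (B s) (B t)).
  by rewrite cardsX !cardB // inE /= xs yt add1n => -[<-].
- by rewrite cardsC1 cardG; have := vertex_gt0 G; rewrite cardG => /prednK->.
Qed.

(** * Complete bipartite graphs *)

Lemma AGM_nat (I : finType) (A : {set I}) (w : I -> nat) :
  #|A| * \prod_(i in A) w i <= \sum_(i in A) w i ^ #|A|.
Proof.
have [->|A0] := set_0Vmem A; first by rewrite cards0.
have {A0}A_gt0 : 0 < #|A| by case: A0 => x xA; apply/card_gt0P; exists x.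
rewrite -(leq_exp2r _ _ A_gt0) -(ler_nat rat) !natrX natrM natr_prod natr_sum.
pose E i := ((w i)%:R ^+ #|A| : rat)%R.
have /leif_AGM[/= agm _] : {in A, forall i, 0 <= E i}%R.
  by move=> i _; rewrite exprn_ge0 ?ler0n.
rewrite [X in (_ <= X ^+ _)%R](eq_bigr E) => [|i _]; last by rewrite natrX.
rewrite exprMn mulrC -ler_pdivlMr ?exprn_gt0 ?ltr0n // -expr_div_n.
by rewrite -prodrXl.
Qed.

(** The values of [w] are split because, in the application, [w] itself is easy
    to sum and [w = 2] is rare. *)
Lemma pow_le_indicator n w : 0 < n -> w <= 2 -> w ^ n <= w + 2 ^ n * (1 < w).
Proof.
by case: w => [|[|[|//]]] n0 _; rewrite ?exp0n ?exp1n // muln1 leq_addl.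
Qed.

Section Bipartite.
Context (G : graph) (n : nat) (C : dp_cover G) (A B : {set G}).
Local Notation L := (lists C).
Local Notation color := (cover_graph C).
Context (fullC : full_cover 3 C) (n_gt0 : 0 < n).
Context (cardA : #|A| = n) (cardB : #|B| = n).
Context (AUB : A :|: B = setT) (disjAB : [disjoint A & B]).
Context (adjAB : forall a b, a \in A -> b \in B -> adj a b).
(* The value of partial colorings outside [A]. *)
Context (x0 : color).

Let adjBA a b : a \in A -> b \in B -> adj b a.
Proof. by move=> aA bB; rewrite adj_sym adjAB. Qed.

Let inB v : (v \in B) = (v \notin A).
Proof.
have := in_setT v; rewrite -AUB inE => /orP[vA|vB].
  by rewrite vA (disjointFr disjAB vA).
by rewrite vB (disjointFl disjAB vB).
Qed.

Let partial := pfamily x0 A (fun a => mem (L a)).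

Let free (g : {ffun G -> color}) b :=
  [set y in L b | [forall a in A, ~~ adj (g a) y]].

Let card_free_le2 g b : g \in partial -> b \in B -> #|free g b| <= 2.
Proof.
move=> /pfamilyP[_ gL] bB; have [foldC _] := fullC.
have /card_gt0P[a aA] : 0 < #|A| by rewrite cardA.
have [y [yb ay]] := full_matched fullC (adjAB aA bB) (gL a aA).
rewrite -ltnS -(foldC b) (cardsD1 y (L b)) yb ltnS subset_leq_card //.
apply/subsetP => z; rewrite !inE => /andP[zb /forall_inP zfree].
by rewrite zb andbT; apply: contraL ay => /eqP <-; apply: zfree.
Qed.

(** Double counting: a color [y] of [b] is free for the partial colorings that
    avoid its partner in each of the [n] lists, so for [2 ^ n] of them. *)
Let sum_free b : b \in B -> \sum_(g in partial) #|free g b| = 3 * 2 ^ n.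
Proof.
move=> bB; have [foldC _] := fullC.
under eq_bigr do rewrite -sum1_card.
rewrite (exchange_big_dep (mem (L b))) /=; last first.
  by move=> g y _; rewrite inE => /andP[].
rewrite -(foldC b) -sum_nat_const; apply: eq_bigr => y yb; rewrite sum1_card.
pose R a := [set x in L a | ~~ adj x y].
transitivity #|pfamily x0 A (fun a => mem (R a))|.
  apply: eq_card => g; rewrite !inE; apply/andP/pfamilyP.
    case=> /pfamilyP[sg gL]; rewrite inE yb => /forall_inP gy; split=> // a aA.
    by rewrite inE gy // gL.
  case=> sg gR; split.
    by apply/pfamilyP; split=> // a /gR; rewrite inE => /andP[].
  by rewrite inE yb; apply/forall_inP => a /gR; rewrite inE => /andP[].
rewrite card_pfamily foldrE big_image /= -cardA -prod_nat_const.
apply: eq_bigr => a aA.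
have [x [xa yx]] := full_matched fullC (adjBA aA bB) yb.
have := cardsD1 x (L a); rewrite foldC xa add1n => -[->].
apply: eq_card => z; rewrite !inE andbC; apply: andb_id2r => za.
rewrite adj_sym; have [->|zx] := eqVneq z x; first by rewrite yx.
apply/negP => yz; case/eqP: zx.
exact: matched_unique (adjBA aA bB) yb za xa yz yx.
Qed.

(** If two colors of [b] are free, then [g] sends every vertex of [A] to the
    partner of the third, so this color determines [g]. *)
Let card_two_free b : b \in B ->
  #|[set g in partial | 1 < #|free g b|]| <= 3.
Proof.
move=> bB; have [foldC _] := fullC.
have mateE (az : G * color) :
    exists x, az.1 \in A -> az.2 \in L b -> x \in L az.1 /\ adj az.2 x.
  case: az => a z /=.
  have [aA|_] := boolP (a \in A); last by exists z.
  have [zb|_] := boolP (z \in L b); last by exists z.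
  by have [x xP] := full_matched fullC (adjBA aA bB) zb; exists x.
have [mate mateP] := fin_all_exists mateE.
(* The partial coloring that excludes only [z] at [b]. *)
pose h z := [ffun a => if a \in A then mate (a, z) else x0].
rewrite -(foldC b); apply: leq_trans (leq_imset_card h _).
apply/subset_leq_card/subsetP => g; rewrite inE.
case/andP => /pfamilyP[sg gL] free2.
have blocked_eq y z : y \in L b -> z \in L b -> y \notin free g b ->
    z \notin free g b -> y = z.
  move=> yb zb yN zN; apply/eqP/contraT => yz.
  have sub : free g b \subset L b :\ y :\ z.
    apply/subsetP => x xf; rewrite !inE (contraNneq _ zN) => [|<- //].
    by rewrite (contraNneq _ yN) => [|<- //]; case/setIdP: xf.
  have := foldC b; rewrite (cardsD1 y) yb (cardsD1 z) !inE zb eq_sym yz.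
  rewrite !add1n => -[cL].
  by have := subset_leq_card sub; rewrite cL leqNgt free2.
have /card_gt0P[a0 a0A] : 0 < #|A| by rewrite cardA.
have blocked a y : a \in A -> adj (g a) y -> y \notin free g b.
  move=> aA ay; rewrite inE; apply/negP => /andP[_ /forall_inP/(_ a aA)].
  by rewrite ay.
have [z [zb a0z]] := full_matched fullC (adjAB a0A bB) (gL a0 a0A).
apply/imsetP; exists z => //; apply/ffunP => a; rewrite ffunE.
case: ifPn => aA; last by apply/eqP; apply: contraNT aA => /(subsetP sg).
have [y [yb ay]] := full_matched fullC (adjAB aA bB) (gL a aA).
have yz := blocked_eq y z yb zb (blocked a y aA ay) (blocked a0 z a0A a0z).
have [/= ma zm] := mateP (a, z) aA zb.
apply: matched_unique (adjBA aA bB) zb (gL a aA) ma _ zm.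
by rewrite adj_sym -yz.
Qed.

(** A coloring restricts to a partial coloring of [A], and its other values are
    free for it. *)
Let card_funs_le :
  #|coloring_funs C| <= \sum_(g in partial) \prod_(b in B) #|free g b|.
Proof.
pose r (f : {ffun G -> color}) := [ffun v => if v \in A then f v else x0].
rewrite -sum1_card (partition_big r (mem partial)) /=; last first.
  move=> f /coloring_funsP[fL _]; apply/pfamilyP; split.
    by apply/subsetP => v; rewrite inE ffunE; case: ifP => // _; rewrite eqxx.
  by move=> a aA; rewrite ffunE aA; apply: fL.
apply: leq_sum => g gP; rewrite sum1dep_card.
pose R v := if v \in A then [set g v] else free g v.
apply: (@leq_trans #|family (fun v => mem (R v))|).
  apply/subset_leq_card/subsetP => f; rewrite inE.
  case/andP => /coloring_funsP[fL fI] /eqP fg.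
  apply/familyP => v; rewrite /R -fg !ffunE; case: ifP => vA.
    by rewrite vA !inE.
  by rewrite !inE fL; apply/forall_inP => a aA; rewrite ffunE aA fI.
rewrite card_family foldrE big_image /= (bigID (mem A)) /= big1 => [|a aA].
  rewrite mul1n (eq_bigl (mem B)) => [|v]; last by rewrite [RHS]inB.
  by apply/eq_leq/eq_bigr => b bB; rewrite /R ifN // -inB.
by rewrite /R aA cards1.
Qed.

Lemma card_coloring_funs_bipartite : #|coloring_funs C| <= 6 * 2 ^ n.
Proof.
apply: leq_trans card_funs_le _; rewrite -(leq_pmul2l n_gt0) big_distrr /=.
apply: (@leq_trans (\sum_(g in partial) \sum_(b in B) #|free g b| ^ n)).
  by apply: leq_sum => g _; rewrite -cardB; apply: AGM_nat.
rewrite exchange_big /= -[X in _ <= X * _]cardB -sum_nat_const.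
apply: leq_sum => b bB.
apply: (@leq_trans
    (\sum_(g in partial) (#|free g b| + 2 ^ n * (1 < #|free g b|)))).
  apply: leq_sum => g gP.
  by apply: pow_le_indicator => //; apply: card_free_le2.
rewrite big_split /= sum_free // -big_distrr /= -[6]/(3 + 3) mulnDl leq_add2l.
rewrite mulnC leq_mul2r.
rewrite (eq_bigr (fun g => if 1 < #|free g b| then 1 else 0)) => [|g _].
  2: by case: (1 < _).
by rewrite -big_mkcondr sum1dep_card card_two_free ?orbT.
Qed.

End Bipartite.

Lemma bipartite_num_colorings (G : graph) n (C : dp_cover G) : 0 < n ->
  is_complete_bipartite G n n -> full_cover 3 C -> num_colorings C <= 6 * 2 ^ n.
Proof.
move=> n_gt0 [A [B [AUB disjAB cardA cardB adjE]]] fullC.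
apply: leq_trans (num_colorings_le_funs C) _.
have /card_gt0P[x0 _] := vertex_gt0 (cover_graph C).
apply: (card_coloring_funs_bipartite fullC n_gt0 cardA cardB AUB disjAB _ x0).
by move=> a b aA bB; rewrite adjE aA bB.
Qed.

(** * Two colours *)

Section Twisted.
Context (G : graph).

(** Opposite colors are joined along the edges so that the constant assignments
    stay independent. *)
Definition twisted_adj : rel (G * bool) := fun x y =>
  ((x.1 == y.1) || adj x.1 y.1) && (x.2 != y.2).

Lemma twisted_adj_sym : symmetric twisted_adj.
Proof.
by move=> x y; rewrite /twisted_adj adj_sym (eq_sym x.1) (eq_sym x.2).
Qed.

Lemma twisted_adj_irr : irreflexive twisted_adj.
Proof. by move=> x; rewrite /twisted_adj !eqxx andbF. Qed.

Lemma twisted_gt0 : 0 < #|{: G * bool}|.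
Proof. by rewrite card_prod card_bool muln_gt0 vertex_gt0. Qed.

Definition twisted_graph : graph :=
  Graph twisted_adj_sym twisted_adj_irr twisted_gt0.

Definition twisted_lists (v : G) : {set twisted_graph} :=
  [set x : G * bool | x.1 == v].

Lemma twisted_listsE v : twisted_lists v = [set (v, true); (v, false)].
Proof.
by apply/setP => -[u []]; rewrite !inE !xpair_eqE ?andbT ?andbF ?orbF.
Qed.

Lemma twisted_lists_inj : injective twisted_lists.
Proof.
by move=> u v /setP/(_ ((u, true) : G * bool)); rewrite !inE eqxx => /esym/eqP.
Qed.

Lemma twisted_partition :
  partition [set twisted_lists v | v : G] [set: twisted_graph]
  /\ #|[set twisted_lists v | v : G]| = #|G|.
Proof.
split; last by rewrite card_imset //; apply: twisted_lists_inj.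
suff -> : [set twisted_lists v | v : G] =
    preim_partition (fun x : twisted_graph => (x : G * bool).1) setT.
  exact: preim_partitionP.
apply/setP => S; apply/imsetP/imsetP => -[].
  move=> v _ ->; exists ((v, true) : G * bool) => //.
  by apply/setP => x; rewrite !inE eq_sym.
move=> x _ ->; exists (x : G * bool).1 => //.
by apply/setP => y; rewrite !inE eq_sym.
Qed.

Lemma twisted_clique v : clique (twisted_lists v).
Proof.
move=> [a i] [b j]; rewrite !inE /= => /eqP-> /eqP->.
by rewrite xpair_eqE eqxx /adj /= /twisted_adj /= eqxx.
Qed.

Lemma twisted_edges u v :
  edges_between (twisted_lists u) (twisted_lists v) != set0 -> u = v \/ adj u v.
Proof.
case/set0Pn => e /imset2P[[a i] [b j]].
rewrite !inE /= => /eqP-> /andP[/eqP-> /andP[/orP[/eqP|] uv _]] _.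
  by left.
by right.
Qed.

Lemma twisted_edgesE u v : adj u v ->
  edges_between (twisted_lists u) (twisted_lists v) =
  [set [set ((u, i) : twisted_graph); (v, ~~ i)] | i : bool].
Proof.
move=> uv; apply/setP => e; apply/imset2P/imsetP.
  case=> -[a i] [b j]; rewrite !inE /=.
  move=> /eqP-> /andP[/eqP-> /andP[_ /= ij]] ->.
  by exists i => //; case: i j ij => -[].
case=> i _ ->.
exists ((u, i) : twisted_graph) ((v, ~~ i) : twisted_graph) => //.
  by rewrite inE.
by rewrite !inE eqxx /adj /= /twisted_adj /= uv orbT; case: i.
Qed.

Lemma twisted_edge_inj u v : adj u v ->
  forall i j x, x \in [set ((u, i) : twisted_graph); (v, ~~ i)] ->
  x \in [set ((u, j) : twisted_graph); (v, ~~ j)] -> i = j.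
Proof.
move=> uv i j x.
have nuv : u != v by apply: contraTneq uv => ->; rewrite adj_irr.
rewrite !inE => /orP[]/eqP->;
  rewrite !xpair_eqE ?(negPf nuv) ?(eq_sym v) ?(negPf nuv).
  by rewrite eqxx orbF => /eqP.
by rewrite eqxx => /eqP/negb_inj.
Qed.

Lemma twisted_matching u v :
  adj u v -> matching (edges_between (twisted_lists u) (twisted_lists v)).
Proof.
move=> uv; rewrite twisted_edgesE //.
apply/trivIsetP => _ _ /imsetP[i _ ->] /imsetP[j _ ->] nij.
rewrite -setI_eq0; apply: contraNT nij => /set0Pn[x /setIP[xi xj]].
by rewrite (twisted_edge_inj uv xi xj).
Qed.

Definition twisted_cover : dp_cover G :=
  DPCover twisted_partition twisted_clique twisted_edges twisted_matching.

Lemma twisted_full : full_cover 2 twisted_cover.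
Proof.
split=> [v|u v uv] /=; first by rewrite twisted_listsE cards2 xpair_eqE andbF.
rewrite twisted_edgesE // card_imset ?card_bool // => i j e.
by apply: (twisted_edge_inj uv (set21 _ _)); rewrite -e set21.
Qed.

Lemma twisted_num_colorings : 1 < num_colorings twisted_cover.
Proof.
pose S (i : bool) : {set twisted_graph} := [set x : G * bool | x.2 == i].
have S_neq : S true != S false.
  have /card_gt0P[v _] := vertex_gt0 G.
  by apply/eqP => /setP/(_ ((v, true) : G * bool)); rewrite !inE.
apply: (@leq_trans #|[set S true; S false]|); first by rewrite cards2 S_neq.
apply/subset_leq_card/subsetP => I SI; rewrite inE.
have [i ->] : exists i, I = S i.
  by case/set2P: SI => ->; [exists true|exists false].
apply/andP; split.
  apply/forall_inP => x; rewrite inE => /eqP xi.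
  apply/forall_inP => y; rewrite inE => /eqP yi.
  by rewrite /adj /= /twisted_adj xi yi eqxx andbF.
have -> : S i = [set ((v, i) : twisted_graph) | v : G].
  apply/setP => -[v j]; rewrite inE /=.
  apply/eqP/imsetP => [->|[w _ [_ ->]] //].
  by exists v.
by rewrite card_imset // => u v [].
Qed.

End Twisted.

Lemma dual_dp2_ge2 (G : graph) : 1 < dual_dp G 2.
Proof.
have [_ maxG] := dual_dpP G (ltn0Sn 1).
exact: leq_trans (twisted_num_colorings G) (maxG _ (twisted_full G)).
Qed.

(** * Comparison of growth rates *)

Lemma complete_growth n : 5 <= n -> 3 * n * 2 ^ n < 2 * 3 ^ n.
Proof.
move=> /subnKC <-; elim: (n - 5) => // m IHm.
rewrite addnS (expnS 2) (expnS 3).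
set p := 2 ^ _ in IHm *; set q := 3 ^ _ in IHm *.
have : (5 + m).+1 * 2 * p <= (5 + m) * 3 * p by rewrite leq_mul2r; lia.
lia.
Qed.

Lemma bipartite_growth n : 10 <= n -> 6 * 2 ^ n * 2 ^ (n + n) < 2 * 3 ^ (n + n).
Proof.
move=> /subnKC <-; move: (n - 10) => m.
rewrite !addnn -!muln2 !(mulnC _ 2) !(expnM _ 2) -mulnA -expnMn.
rewrite -[6]/(2 * 3) -mulnA ltn_pmul2l // -[2 * 2 ^ 2]/8 -[3 ^ 2]/9.
(* [(9/8) ^ 2 > 5/4] and [(5/4) ^ 5 > 3] *)
have base : 3 * 8 ^ 10 < 9 ^ 10.
  rewrite !(expnM _ 2 5) -[8 ^ 2]/(16 * 4) -[9 ^ 2]/81.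
  apply: (@leq_trans ((16 * 5) ^ 5)); last by rewrite leq_exp2r.
  by rewrite !expnMn mulnCA ltn_pmul2l ?expn_gt0.
rewrite !expnD mulnA.
(* Keep these numbers symbolic, so that no step evaluates them in unary. *)
move: (8 ^ 10) (9 ^ 10) base => a b base.
apply: (@leq_ltn_trans (3 * a * 9 ^ m)).
  rewrite leq_mul2l; have [->|m_gt0] := posnP m; first by rewrite orbT.
  by rewrite leq_exp2r ?orbT.
by rewrite ltn_pmul2r ?expn_gt0.
Qed.

Lemma ratio_lt (G : graph) b :
  dual_dp G 3 <= b -> b * 2 ^ #|G| < 2 * 3 ^ #|G| ->
  ((dual_dp G 3)%:R / 3%:R ^+ #|G| < (dual_dp G 2)%:R / 2%:R ^+ #|G| :> rat)%R.
Proof.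
move=> d3 growth; rewrite ltr_pdivrMr ?exprn_gt0 ?ltr0n // mulrAC.
rewrite ltr_pdivlMr ?exprn_gt0 ?ltr0n // -!natrX -!natrM ltr_nat.
apply: leq_ltn_trans (leq_mul d3 (leqnn _)) (leq_trans growth _).
by rewrite leq_mul2r dual_dp2_ge2 orbT.
Qed.

Local Open Scope ring_scope.

Theorem proposition7 (G : graph)
  (hG : (exists2 n : nat, (5 <= n)%N & is_complete G n) \/
        (exists2 n : nat, (10 <= n)%N & is_complete_bipartite G n n)) :
  (dual_dp G 3)%:R / 3%:R ^+ #|G| < (dual_dp G 2)%:R / 2%:R ^+ #|G| :> rat.
Proof.
have [[C fullC numC] _] := dual_dpP G (ltn0Sn 2).
case: hG => -[n n_ge hG]; apply: ratio_lt.
- by rewrite -numC; apply: complete_num_colorings hG fullC.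
- by rewrite (proj1 hG) complete_growth.
- rewrite -numC; apply: bipartite_num_colorings hG fullC.
  exact: leq_trans n_ge.
have [A [B [AUB disjAB cardA cardB _]]] := hG.
have -> : #|G| = (n + n)%N.
  rewrite -cardsT -AUB -{1}cardA -cardB.
  by apply/eqP; rewrite (leq_card_setU A B).
exact: bipartite_growth.
Qed.
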